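(* Let $(\Omega, \Sigma, \mathsf{P})$ be the product probability space $\prod_{k=1}^{\infty} ([k], \mathcal{P}([k]), \mathsf{c}_k)$, where $[k] = \{1, \dots, k\}$, $\mathcal{P}([k])$ is the power set of $[k]$, and $\mathsf{c}_k$ is the uniform probability measure on $[k]$, i.e. $\mathsf{c}_k(A) = \frac{\mathrm{Card}(A)}{k}$ for all $A \subseteq [k]$. Let $\mathsf{RV}(\Omega,\Sigma)$ be the $\mathbb{R}$-vector space of all random variables on $(\Omega,\Sigma)$, and let $\tau_{\mathsf{P}}$ be the topology on $\mathsf{RV}(\Omega,\Sigma)$ generated by the pseudo-metric $$\rho_{\mathsf{P}}(X,Y) = \int_{\Omega} \frac{|X - Y|}{1 + |X - Y|} \, \mathrm{d}\mathsf{P}, \qquad X, Y \in \mathsf{RV}(\Omega,\Sigma).$$ Then $(\mathsf{RV}(\Omega,\Sigma), \tau_{\mathsf{P}})$ is a bad topological vector space.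
   Context: $\mathbb{N}$ denotes the set of positive integers. A random variable on $(\Omega,\Sigma)$ is a measurable function from $(\Omega,\Sigma)$ to $\mathbb{R}$ with its Borel $\sigma$-algebra; random variables are functions and are not identified when they agree almost surely. A topological vector space is a pair $(V,\tau)$ where $V$ is a vector space over $\mathbb{K} \in \{\mathbb{R},\mathbb{C}\}$ (here $\mathbb{K} = \mathbb{R}$) and $\tau$ is a topology on $V$ (not assumed to be Hausdorff) under which vector addition and scalar multiplication are continuous. A point $x \in V$ is a $\tau$-limit of a sequence $(x_n)_{n \in \mathbb{N}}$ in $V$ if for each $\tau$-neighborhood $U$ of $x$ there is $n_0 \in \mathbb{N}$ such that $x_n \in U$ for all $n \geq n_0$ (limits need not be unique). A topological vector space $(V,\tau)$ is called good if and only if any sequence $(x_n)_{n \in \mathbb{N}}$ in $V$ has a $\tau$-limit whenever the sequence $(2x_{n+1} - x_n)_{n \in \mathbb{N}}$ has a $\tau$-limit. A topological vector space that is not good is called bad. *)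

(* Defs.v *)
From HB Require Import structures.
From mathcomp Require Import all_boot all_order all_algebra.
From mathcomp Require Import all_classical all_reals all_analysis.
From mathcomp Require Import measurable_realfun ring lra.
Import Order.TTheory GRing.Theory Num.Theory.
Import numFieldNormedType.Exports.
Set Implicit Arguments.
Unset Strict Implicit.
Unset Printing Implicit Defensive.
Local Open Scope classical_set_scope.
Local Open Scope ring_scope.

Section tvs.
Context (R : realType).
Implicit Type V : preTopologicalLmodType R.

(* The addition and scaling axioms of the library's topologicalLmodType, as a
   predicate (its third axiom, continuity of the opposite, follows from scaling).
   The library's tvsType is unsuitable: it requires local convexity. *)
Definition is_topological_vector_space V : Prop :=
  continuous (fun z : V * V => z.1 + z.2) /\
  continuous (fun z : R^o * V => z.1 *: z.2).

(* Limits need not be unique, so convergence is `exists l, _ --> l` rather than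
   a statement about `lim`. *)
Definition good V : Prop :=
  forall x : nat -> V,
    (exists l : V, (fun n => 2 *: x n.+1 - x n) @ \oo --> l) ->
    exists l : V, x @ \oo --> l.

Definition bad_topological_vector_space V : Prop :=
  is_topological_vector_space V /\ ~ good V.

End tvs.

Section product_space.
Context (d : nat -> measure_display) (T : forall k, measurableType (d k)).

Definition coordinate_sets : set (set (forall k, T k)) :=
  \bigcup_k
    preimage_set_system setT (fun w : forall k, T k => w k) measurable.

Definition product_space : Type := g_sigma_algebraType coordinate_sets.

HB.instance Definition _ := Measurable.on product_space.

Context (R : realType).

(* At most one P satisfies this, by the pi-lambda theorem; for the uniform
   probabilities below one exists, see product_probability_exists. *)
Definition is_product_probability (Pk : forall k, probability (T k) R)
    (P : probability product_space R) : Prop :=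
  forall (n : nat) (A : forall k, set (T k)), (forall k, measurable (A k)) ->
    (P [set w | forall k, (k < n)%N -> A k (w k)] =
     \prod_(k < n) Pk k (A k))%E.

End product_space.

Section discrete_ordinal.
Context (n : nat).

HB.instance Definition _ := isPointed.Build 'I_n.+1 ord0.

HB.instance Definition _ := @isMeasurable.Build default_measure_display
  'I_n.+1 discrete_measurable discrete_measurable0
  discrete_measurableC discrete_measurableU.

End discrete_ordinal.

Section uniform_ordinal.
Context (R : realType) (n : nat).

(* 'I_n.+1 stands for {1, ..., n + 1}, relabelled from 0. *)
Definition uniform_ord (A : set 'I_n.+1) : \bar R := (#|A|%:R / n.+1%:R)%:E.

Let m : {measure set 'I_n.+1 -> \bar R} :=
  mscale (n.+1%:R^-1)%:nng (msum (fun k => dirac (inord k : 'I_n.+1)) n.+1).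

Let uniform_ordE A : uniform_ord A = m A.
Proof.
rewrite /m /mscale/= /uniform_ord mulrC EFinM; congr (_ * _)%E.
transitivity (\sum_(i < n.+1) ((i \in A)%:R : R)%:E)%E; last first.
  by apply: eq_bigr => i _; rewrite inord_val.
by rewrite sumEFin -natr_sum -big_mkcond sum1_card.
Qed.

Let uniform_ord0 : uniform_ord set0 = 0%E.
Proof. by rewrite uniform_ordE measure0. Qed.

Let uniform_ord_ge0 A : (0 <= uniform_ord A)%E.
Proof. by rewrite uniform_ordE. Qed.

Let uniform_ord_sigma_additive : semi_sigma_additive uniform_ord.
Proof.
by rewrite (_ : uniform_ord = m); [exact: measure_semi_sigma_additive|
  apply/funext => A; exact: uniform_ordE].
Qed.

HB.instance Definition _ := isMeasure.Build _ _ _ uniform_ord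
  uniform_ord0 uniform_ord_ge0 uniform_ord_sigma_additive.

Let uniform_ordT : uniform_ord setT = 1%E.
Proof.
rewrite /uniform_ord (_ : #|_| = n.+1) ?divff//.
by rewrite -[RHS]card_ord; apply: eq_card => i; exact: mem_set.
Qed.

HB.instance Definition _ :=
  @Measure_isProbability.Build _ _ R uniform_ord uniform_ordT.

End uniform_ordinal.
Arguments uniform_ord : clear implicits.

(* All measurable functions, not classes modulo P-a.e. equality; P only selects
   the topology. *)
Definition RV d (T : measurableType d) (R : realType) (P : probability T R)
  : Type := {mfun T >-> R}.

Section random_variables.
Context d (T : measurableType d) (R : realType) (P : probability T R).

HB.instance Definition _ := GRing.Lmodule.on (RV P).

Implicit Types X Y Z : RV P.

Definition rho X Y : R :=
  let f : T -> R := X in let g : T -> R := Y in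
  \int[P]_w (`|f w - g w| / (1 + `|f w - g w|)).

Let phi (a : R) := `|a| / (1 + `|a|).

Let phi_ge0 a : 0 <= phi a.
Proof. by rewrite /phi divr_ge0// addr_ge0. Qed.

Let phi_le1 a : phi a <= 1.
Proof. by rewrite /phi ler_pdivrMr ?mul1r ?lerDr// ltr_wpDr. Qed.

Let phiE a : phi a = 1 - (1 + `|a|)^-1.
Proof.
have h : 1 + `|a| != 0 by rewrite gt_eqF// ltr_wpDr.
by rewrite /phi -{1}[`|a|](addKr 1) mulrDl divff// mulN1r addrC.
Qed.

Let phi_triangle a b c : phi (a - c) <= phi (a - b) + phi (b - c).
Proof.
set u := a - b; set v := b - c; have -> : a - c = u + v by rewrite /u /v; ring.
apply: (@le_trans _ _ (1 - (1 + (`|u| + `|v|))^-1)).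
  by rewrite phiE lerB// lef_pV2 ?posrE ?ltr_wpDr ?addr_ge0// lerD2l ler_normD.
rewrite !phiE.
move: (normr_ge0 u) (normr_ge0 v); set x := `|u|; set y := `|v| => x0 y0.
have hx : 1 + x != 0 by rewrite gt_eqF// ltr_wpDr.
have hy : 1 + y != 0 by rewrite gt_eqF// ltr_wpDr.
have hxy : 1 + (x + y) != 0 by rewrite gt_eqF// ltr_wpDr// addr_ge0.
rewrite -subr_ge0.
have -> : 1 - (1 + x)^-1 + (1 - (1 + y)^-1) - (1 - (1 + (x + y))^-1) =
   x * y * (2 + x + y) / ((1 + x) * (1 + y) * (1 + (x + y))).
  by field; rewrite hx hy hxy.
by rewrite divr_ge0 ?mulr_ge0 ?addr_ge0.
Qed.

Let phi_measurable : measurable_fun setT phi.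
Proof.
apply: continuous_measurable_fun => a; rewrite /phi.
have na : (fun b : R => `|b|) @ a --> `|a| by exact: norm_continuous.
apply: cvgM => //; apply: cvgV; first by rewrite gt_eqF// ltr_wpDr.
by apply: cvgD => //; exact: cvg_cst.
Qed.

Let phi_integrable X Y : P.-integrable setT
  (EFin \o (fun w => phi ((X : T -> R) w - (Y : T -> R) w))).
Proof.
apply: measurable_bounded_integrable => //.
- exact: le_lt_trans (probability_le1 P measurableT) (ltry 1).
- apply: (measurableT_comp phi_measurable).
  by apply: measurable_funB; exact: measurable_funPT.
- exists 1; split => // M M1 w _ /=.
  by rewrite ger0_norm ?phi_ge0// (le_trans (phi_le1 _))// ltW.
Qed.

Let rhoxx X : rho X X = 0.
Proof.
rewrite /rho; under eq_Rintegral do rewrite subrr normr0 mul0r.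
by rewrite /Rintegral integral0.
Qed.

Let rho_sym X Y : rho X Y = rho Y X.
Proof. by apply: eq_Rintegral => w _; rewrite distrC. Qed.

Let rho_triangle X Y Z : rho X Z <= rho X Y + rho Y Z.
Proof.
rewrite /rho -RintegralD//; [|exact: phi_integrable..].
apply: le_Rintegral => //; first exact: phi_integrable.
  under [X in _.-integrable _ X]eq_fun do rewrite /= EFinD.
  by apply: integrableD => //; exact: phi_integrable.
by move=> w _; exact: phi_triangle.
Qed.

Let rho_ball X (e : R) : set (RV P) := [set Y | rho X Y < e].

Let ball_center X (e : R) : 0 < e -> rho_ball X e X.
Proof. by rewrite /rho_ball /= rhoxx. Qed.

Let ball_sym X Y (e : R) : rho_ball X e Y -> rho_ball Y e X.
Proof. by rewrite /rho_ball /= rho_sym. Qed.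

Let ball_triangle X Y Z (e1 e2 : R) :
  rho_ball X e1 Y -> rho_ball Y e2 Z -> rho_ball X (e1 + e2) Z.
Proof.
move=> XY YZ; apply: le_lt_trans (rho_triangle X Y Z) _; exact: ltrD.
Qed.

HB.instance Definition _ := hasNbhs.Build (RV P) (nbhs_ (entourage_ rho_ball)).

HB.instance Definition _ := Nbhs_isPseudoMetric.Build R (RV P)
  erefl ball_center ball_sym ball_triangle erefl.

Lemma RV_ballE X (e : R) : ball X e = [set Y | rho X Y < e].
Proof. by []. Qed.

End random_variables.

Section product_probability_exists.
Context (R : realType).

Let Omega := product_space (fun k => 'I_k.+1).

Let tr (N : nat) (x : R) : nat := Num.truncn (x * N%:R).

(* Mixed-radix digits: x = \sum_k digits x k / (k.+1)! for 0 <= x < 1. *)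
Let digits (x : R) : Omega :=
  fun k => Ordinal (ltn_pmod (tr k.+1`! x) (ltn0Sn k)).

Let measurable_tr N (F : set nat) : measurable [set x : R | F (tr N x)].
Proof.
have mle m : measurable [set x : R | (tr N x <= m)%N].
  rewrite (_ : [set x : R | _] = (fun x => x * N%:R) @^-1` `]-oo, m.+1%:R[).
    rewrite -[X in measurable X]setTI; apply: measurable_funM => //.
  by apply/seteqP; split => x /=; rewrite in_itv/= /tr truncn_le_nat.
have meq m : measurable [set x : R | tr N x = m].
  case: m => [|m].
    by rewrite (_ : [set x : R | _] = [set x : R | (tr N x <= 0)%N])//;
      apply/seteqP; split => x /= => [->//|]; rewrite leqn0 => /eqP.
  rewrite (_ : [set x : R | _] =
      [set x : R | (tr N x <= m.+1)%N] `\` [set x : R | (tr N x <= m)%N]).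
    exact: measurableD.
  apply/seteqP; split => x /= => [->|[]]; first by split => //; rewrite ltnn.
  by move=> h1 /negP h2; apply/eqP; rewrite eqn_leq h1 ltnNge.
rewrite (_ : [set x : R | _] = \bigcup_(m in F) [set x : R | tr N x = m]).
  exact: bigcup_measurable.
apply/seteqP; split => x /=; first by move=> h; exists (tr N x).
by case=> m Fm /= ->.
Qed.

Let measurable_digits : measurable_fun setT digits.
Proof.
apply: (@measurability _ _ _ Omega _ _ (@coordinate_sets _ (fun k => 'I_k.+1))) => //.
move=> _ [_ [k _ [B _ <-]] <-]; rewrite !setTI.
exact: (measurable_tr k.+1`!
  [set m | B (Ordinal (ltn_pmod m (ltn0Sn k)))]).
Qed.

Let mitv : measurable (`[0, 1[%classic : set R). Proof. exact: measurable_itv. Qed.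

Let mu : {measure set (measurableTypeR R) -> \bar R} := mrestr lebesgue_measure mitv.

Let muT : mu setT = 1%E.
Proof. by rewrite /mu /= /mrestr setTI lebesgue_measure_itv/= lte01 oppr0 adde0. Qed.

Let mu_tr N (F : pred nat) : (0 < N)%N ->
  mu [set x | F (tr N x)] = ((\sum_(0 <= m < N) F m)%N%:R / N%:R)%:E.
Proof.
move=> N0; have N0' : 0 < N%:R :> R by rewrite ltr0n.
pose I m : set R := if F m then `[m%:R / N%:R, m.+1%:R / N%:R[%classic else set0.
have -> : mu [set x | F (tr N x)] = lebesgue_measure (\big[setU/set0]_(m < N) I m).
  rewrite /mu /= /mrestr; congr lebesgue_measure.
  rewrite -bigcup_mkord; apply/seteqP; split => x /=.
    case=> Fx; rewrite in_itv/= => /andP[x0 x1].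
    have xN0 : 0 <= x * N%:R by rewrite mulr_ge0.
    exists (tr N x); first by rewrite /= /tr truncn_lt_nat// gtr_pMl.
    rewrite /I Fx/= in_itv/= ler_pdivrMr// ltr_pdivlMr//.
    exact: truncn_itv.
  case=> m /= mN; rewrite /I; case: ifPn => // Fm; rewrite /= in_itv/=.
  rewrite ler_pdivrMr// ltr_pdivlMr// => xm.
  rewrite /tr (truncn_def xm) Fm in_itv/=; split=> //.
  case/andP: xm => mx xm; apply/andP; split.
    by rewrite -(pmulr_lge0 _ N0') (le_trans _ mx).
  by rewrite -(ltr_pM2r N0') mul1r (lt_le_trans xm)// ler_nat.
rewrite measure_bigsetU//; last 2 first.
- by move=> m; rewrite /I; case: ifP => // _; exact: measurable_itv.
- apply/trivIsetP => i j _ _ ij; apply/seteqP; split => // x [].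
  rewrite /I; case: ifP => // _; case: ifP => // _.
  rewrite /= !in_itv/= !ler_pdivrMr// !ltr_pdivlMr// => /truncn_def h1 /truncn_def h2.
  by move: ij; rewrite -h1 -h2 eqxx.
rewrite big_mkord natr_sum mulr_suml -sumEFin; apply: eq_bigr => m _.
rewrite /I; case: (F m); last by rewrite measure0 mul0r.
rewrite [LHS]lebesgue_measure_itv/= lte_fin ltr_pM2r ?invr_gt0// ltr_nat ltnSn.
by rewrite -EFinB -mulrBl -[m.+1]addn1 natrD addrAC subrr add0r.
Qed.

Section cylinder.
Context (A : forall k, set 'I_k.+1).

Let dig n (m : nat) : bool := Ordinal (ltn_pmod m (ltn0Sn n)) \in @A n.

Let Fixpoint ok n (m : nat) : bool :=
  if n is n'.+1 then ok n' (m %/ n)%N && dig n' m else true.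

Let okE n x : 0 <= x ->
  ok n (tr n`! x) = true <-> forall k, (k < n)%N -> @A k (digits x k).
Proof.
move=> x0; elim: n => [|n IH]; first by split.
have -> : ok n.+1 (tr n.+1`! x) = ok n (tr n`! x) && dig n (tr n.+1`! x).
  rewrite /= ; congr (ok n _ && _); rewrite /tr.
  have y0 : 0 <= x * n`!%:R by rewrite mulr_ge0.
  rewrite factS mulnC natrM mulrA; set y := x * n`!%:R in y0 *.
  apply/esym/truncn_def; have n0 : 0 < n.+1%:R :> R by [].
  have z0 : 0 <= y * n.+1%:R by rewrite mulr_ge0.
  have /andP[h1 h2] := truncn_itv z0; set t := Num.truncn _ in h1 h2 *.
  apply/andP; split.
    rewrite -(ler_pM2r n0) (le_trans _ h1)// -natrM ler_nat.
    exact: leq_divM.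
  rewrite -(ltr_pM2r n0) (lt_le_trans h2)// -natrM ler_nat.
  by rewrite -ltn_divLR.
split=> [/andP[/IH h hd] k|h].
  rewrite ltnS leq_eqVlt => /orP[/eqP ->|]; last exact: h.
  exact: set_mem.
apply/andP; split; first by apply/IH => k kn; apply: h; exact: ltnW.
by apply: mem_set; exact: h.
Qed.

Let ok_count n :
  (\sum_(0 <= m < n`!) ok n m)%N = (\prod_(k < n) #|@A k|)%N.
Proof.
elim: n => [|n IH]; first by rewrite big_ord0 big_nat1.
rewrite big_ord_recr/= -IH factS mulnC big_nat_mul big_distrl/=.
apply: eq_bigr => i _.
rewrite -{1}[(i * n.+1)%N]add0n big_addn mulSn addnK big_mkord.
rewrite -sum1_card big_distrr/= [RHS]big_mkcond/=; apply: eq_bigr => j _.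
rewrite addnC divnMDl// divn_small// addn0 /dig.
rewrite (_ : Ordinal _ = j); last by apply: val_inj; rewrite /= modnMDl modn_small.
by rewrite muln1; case: (ok n i); case: (j \in @A n).
Qed.

Local Lemma digits_cylinder n :
  mu (digits @^-1` [set w | forall k, (k < n)%N -> @A k (w k)]) =
  (\prod_(k < n) uniform_ord R k (@A k))%E.
Proof.
transitivity (mu [set x | ok n (tr n`! x)]).
  rewrite /mu /= /mrestr; congr lebesgue_measure.
  apply/seteqP; split => x /= [h x01]; split => //;
    by move: (x01); rewrite in_itv/= => /andP[x0 _]; apply/(okE n x0).
rewrite mu_tr ?fact_gt0// ok_count.
elim: n => [|n IH]; first by rewrite !big_ord0 divr1.
rewrite !big_ord_recr/= -IH /uniform_ord -EFinM factS !natrM.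
by congr (_%:E); rewrite mulf_div; congr (_ / _); rewrite mulrC.
Qed.

End cylinder.

Let measure_probability d (T : measurableType d)
    (M : {measure set T -> \bar R}) :
  M setT = 1%E -> exists P : probability T R, P = M :> (set T -> \bar R).
Proof.
move=> M1; exists (mnormalize M (dirac point)); apply/funext => A.
by rewrite /= /mnormalize M1 onee_eq0/= invr1 mule1.
Qed.

Lemma product_probability_exists :
  exists P : probability Omega R, is_product_probability (uniform_ord R) P.
Proof.
pose Q := @pushforward _ _ (measurableTypeR R) Omega R mu digits.
have Q1 : Q setT = 1%E by rewrite /Q /pushforward preimage_setT muT.
pose Qm : {measure set Omega -> \bar R} :=
  measure_function_pushforward__canonical__measure_function_Measure
    mu measurable_digits.
have [P PQ] := measure_probability (M := Qm) Q1.
exists P => n A mA; rewrite PQ; exact: digits_cylinder.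
Qed.

End product_probability_exists.

(* Main.v *)
Require Import Defs.
From mathcomp Require Import all_boot all_order all_algebra.
From mathcomp Require Import all_classical all_reals all_analysis.
From mathcomp Require Import measurable_realfun ring lra.
Import Order.TTheory GRing.Theory Num.Theory.
Import numFieldNormedType.Exports.
Set Implicit Arguments.
Unset Strict Implicit.
Unset Printing Implicit Defensive.
Local Open Scope classical_set_scope.
Local Open Scope ring_scope.

(** The convergence of [2 x_(n+1) - x_n] fails to control [x_n] because
    convergence in probability does not see how large a random variable is on
    an event of small probability.  Let [A_k] be the event that the [k]-th
    coordinate takes its first value; these events are independent,
    [A_k] has probability [1 / (k + 1)], and the sum of these probabilities
    diverges.  Put [x_0 = 0] and choose the other terms so that
    [2 x_(n+1) - x_n = 2^n 1_(A_n)].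

    The right-hand side vanishes off [A_n], so it tends to [0] in probability
    whatever its height ([bad_seq_residual_cvg0]).  The heights are chosen so
    that a spike outlives the halvings for long enough: by
    [2^(n+1) x_(n+1) = 2^n x_n + 4^n 1_(A_n)], a hit at a time [m <= j < 2m]
    makes [x_(2m)] at least [1].  By independence the probability of no hit at
    these times telescopes to [m / 2m = 1 / 2] ([probability_no_hit]), so
    [x_(2m)] stays away from [0] ([fnorm_bad_seq]).  Finally [0] is the only possible limit up to
    indistinguishable points, since [x_n --> X] forces
    [2 x_(n+1) - x_n --> X] ([cvg_averaging_lim0]).

    That random variables form a topological vector space is read off from the
    F-seminorm [fnorm X = \int phi(X)] with [phi a = |a| / (1 + |a|)], for which
    [rho X Y = fnorm (X - Y)]: it is subadditive, scaling by [c] multiplies it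
    by at most [max(1, |c|)], and [fnorm (c X)] tends to [0] with [c]
    ([fnormZ_cvg0]). *)

(** * The bounded gauge of the real line *)

Section phi.
Context (R : realType).
Implicit Types a b c : R.

Definition phi a : R := `|a| / (1 + `|a|).

Lemma phi_den_gt0 a : 0 < 1 + `|a|.
Proof. by rewrite ltr_wpDr. Qed.

Lemma phi0 : phi 0 = 0.
Proof. by rewrite /phi normr0 mul0r. Qed.

Lemma phi_ge0 a : 0 <= phi a.
Proof. by rewrite /phi divr_ge0// addr_ge0. Qed.

Lemma phi_le1 a : phi a <= 1.
Proof. by rewrite /phi ler_pdivrMr ?phi_den_gt0// mul1r lerDr. Qed.

Lemma phi_norm a : phi `|a| = phi a.
Proof. by rewrite /phi normr_id. Qed.

Lemma ler_phi a b : `|a| <= `|b| -> phi a <= phi b.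
Proof.
move=> ab; rewrite /phi ler_pdivrMr ?phi_den_gt0// mulrAC.
rewrite ler_pdivlMr ?phi_den_gt0//; nra.
Qed.

Lemma phiD a b : phi (a + b) <= phi a + phi b.
Proof.
rewrite -(phi_norm (a + b)).
apply: (@le_trans _ _ (phi (`|a| + `|b|))).
  by apply: ler_phi; rewrite normr_id [leRHS]ger0_norm ?addr_ge0// ler_normD.
have [ha hb] := (normr_ge0 a, normr_ge0 b).
rewrite {1}/phi ger0_norm ?addr_ge0// mulrDl.
apply: lerD; rewrite ler_wpM2l// lef_pV2 ?posrE ?ltr_wpDr ?addr_ge0//; lra.
Qed.

(** Since [phi] is concave on the nonnegative reals, a dilation by a factor
    at least [1] increases it at most by that factor.  The bound [M] is free so
    that it can be uniform in [c]. *)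
Lemma phiM M c a : 1 <= M -> `|c| <= M -> phi (c * a) <= M * phi a.
Proof.
move=> M1 cM; have M0 : 0 <= M by exact: le_trans M1.
apply: (@le_trans _ _ (phi (M * a))).
  by apply: ler_phi; rewrite !normrM ler_wpM2r// (ger0_norm M0).
rewrite /phi normrM (ger0_norm M0) -mulrA ler_wpM2l// ler_wpM2l//.
rewrite lef_pV2 ?posrE ?ltr_wpDr ?mulr_ge0// lerD2l.
by rewrite ler_peMl.
Qed.

Lemma continuous_phi : continuous phi.
Proof.
move=> a; have na : (fun b : R => `|b|) @ a --> `|a| by exact: norm_continuous.
apply: cvgM => //; apply: cvgV; first by rewrite gt_eqF// phi_den_gt0.
by apply: cvgD => //; exact: cvg_cst.
Qed.

End phi.

(** * The topology of convergence in probability *)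

Section fnorm.
Context d (T : measurableType d) (R : realType) (P : probability T R).
Implicit Types X Y : RV P.

Definition fnorm X : R := \int[P]_w phi ((X : T -> R) w).

Lemma rhoE X Y : rho X Y = fnorm (X - Y).
Proof. by []. Qed.

Lemma phi_integrable (f : T -> R) : measurable_fun setT f ->
  P.-integrable setT (EFin \o (fun w => phi (f w))).
Proof.
move=> mf; apply: measurable_bounded_integrable => //.
- exact: le_lt_trans (probability_le1 P measurableT) (ltry 1).
- apply: (measurableT_comp _ mf).
  by apply: continuous_measurable_fun => a; exact: continuous_phi.
- exists 1; split => // M M1 w _ /=.
  by rewrite ger0_norm ?phi_ge0// (le_trans (phi_le1 _))// ltW.
Qed.

Lemma RV_integrable X : P.-integrable setT
  (EFin \o (fun w => phi ((X : T -> R) w))).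
Proof. by apply: phi_integrable; exact: measurable_funPT. Qed.

Lemma fnormD X Y : fnorm (X + Y) <= fnorm X + fnorm Y.
Proof.
rewrite /fnorm -RintegralD//; [|exact: RV_integrable..].
apply: le_Rintegral => //; first exact: RV_integrable.
  under [X in _.-integrable _ X]eq_fun do rewrite /= EFinD.
  by apply: integrableD => //; exact: RV_integrable.
by move=> w _; exact: phiD.
Qed.

Lemma fnormZ (M c : R) X : 1 <= M -> `|c| <= M ->
  fnorm (c *: X) <= M * fnorm X.
Proof.
move=> M1 cM; rewrite /fnorm -RintegralZl//; last exact: RV_integrable.
apply: le_Rintegral => //; first exact: RV_integrable.
  under [X in _.-integrable _ X]eq_fun do rewrite /= EFinM.
  by apply: integrableZl => //; exact: RV_integrable.
by move=> w _; exact: phiM.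
Qed.

Lemma fnormN X : fnorm (- X) = fnorm X.
Proof. by apply: eq_Rintegral => w _; rewrite /phi /= normrN. Qed.

(** This is where finiteness of the random variable enters:
    [phi (c X)] tends to [0] pointwise and is dominated by the constant [1],
    which is integrable for a probability. *)
Lemma fnormZ_cvg0 X : (fun c : R => fnorm (c *: X)) @ 0 --> (0 : R).
Proof.
have mX : measurable_fun setT (X : T -> R) by exact: measurable_funPT.
have : {in (`]-1, 1[%classic : set R), continuous
    (fun c : R => \int[P]_w phi (c * (X : T -> R) w))}.
  apply: (@continuity_under_integral R d T P _ setT measurableT
    (-1) 1 _ _ (cst 1)) => //=.
  - by move=> c _; apply: phi_integrable; exact: measurable_funM.
  - apply: aeW => w _ c _.
    apply: (@continuous_comp R R R (fun l : R => l * _) (@phi R)); last first.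
      exact: continuous_phi.
    by apply: cvgM; [exact: cvg_id|exact: cvg_cst].
  - exact: finite_measure_integrable_cst.
  - move=> c _; apply: aeW => w _.
    by rewrite ger0_norm ?phi_ge0// phi_le1.
move=> /(_ 0); rewrite inE/= in_itv/= ltrN10 ltr01 => /(_ isT).
rewrite /continuous_at (_ : (\int[P]_(x in _) _) = 0)//.
under eq_Rintegral do rewrite mul0r phi0.
by rewrite /Rintegral integral0.
Qed.

Lemma Rintegral_indicT (A : set T) : measurable A ->
  \int[P]_w (\1_A w) = fine (P A).
Proof. by move=> mA; rewrite /Rintegral integral_indic// setIT. Qed.

Lemma indic_integrable (A : set T) : measurable A ->
  P.-integrable setT (EFin \o (\1_A : T -> R)).
Proof. by move=> mA; exact: integrable_indic. Qed.

(** The height of [X] on [A] is immaterial because [phi] is bounded by [1]: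
    arbitrarily tall spikes on rare events are small. *)
Lemma fnorm_le_probability X (A : set T) : measurable A ->
  (forall w, ~ A w -> (X : T -> R) w = 0) -> fnorm X <= fine (P A).
Proof.
move=> mA X0; rewrite -Rintegral_indicT//.
apply: le_Rintegral => //; [exact: RV_integrable|exact: indic_integrable|].
move=> w _; rewrite indicE; have [/set_mem Aw|/negP Aw] := boolP (w \in A).
  exact: phi_le1.
by rewrite X0 ?phi0// => /mem_set.
Qed.

(** The constant is [phi 1 = 1 / 2]. *)
Lemma half_probability_le_fnorm X (A : set T) : measurable A ->
  (forall w, A w -> 1 <= (X : T -> R) w) -> 2^-1 * fine (P A) <= fnorm X.
Proof.
move=> mA X1; rewrite -Rintegral_indicT// -RintegralZl//; last first.
  exact: indic_integrable.
apply: le_Rintegral => //; last 1 first.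
- move=> w _; rewrite indicE; have [/set_mem/X1 Aw|_] := boolP (w \in A).
    rewrite mulr1 /phi ler_pdivlMr ?phi_den_gt0//.
    by rewrite (ger0_norm (le_trans ler01 Aw)); lra.
  by rewrite mulr0 phi_ge0.
- under [X in _.-integrable _ X]eq_fun do rewrite /= EFinM.
  by apply: integrableZl => //; exact: indic_integrable.
- exact: RV_integrable.
Qed.

(** Joint continuity of scaling comes from splitting
    [c X - c' X' = (c - c') X + c' (X - X')]: the first term is small by
    [fnormZ_cvg0] at the fixed [X], the second by [fnormZ] with the bound
    [|c| + 1] valid for all [c'] at distance at most [1] from [c]. *)
Lemma RV_tvs : is_topological_vector_space (RV P).
Proof.
split.
  move=> [X Y]; apply/cvg_ballP => e e0.
  exists (ball X (e / 2), ball Y (e / 2)) => /=.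
    by split; apply: nbhsx_ballx; rewrite divr_gt0.
  move=> [X' Y'] [/= hX hY]; rewrite RV_ballE /= rhoE.
  rewrite (_ : _ - _ = (X - X') + (Y - Y')); last by rewrite addrACA opprD.
  rewrite (le_lt_trans (fnormD _ _))// [ltRHS]splitr.
  by rewrite -!rhoE ltrD.
move=> [c X]; apply/cvg_ballP => e e0.
have M1 : 1 <= `|c| + 1 by rewrite lerDr.
have M0 : 0 < `|c| + 1 by exact: lt_le_trans M1.
have /cvgr_dist_lt/(_ (e / 2)) := fnormZ_cvg0 X.
rewrite divr_gt0// => /(_ isT) /nbhs_ballP[r /= r0 hr].
exists (ball (c : R) (Num.min r 1), ball X (e / 2 / (`|c| + 1))) => /=.
  split; apply: nbhsx_ballx; first by rewrite lt_min r0/=.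
  by rewrite !divr_gt0.
move=> [c' X'] [/= hc hX]; rewrite RV_ballE /= rhoE.
rewrite (_ : _ - _ = (c - c') *: X + c' *: (X - X')); last first.
  by rewrite scalerBl scalerBr addrA subrK.
move: hc; rewrite /ball /= lt_min => /andP[cr c1].
rewrite (le_lt_trans (fnormD _ _))// [ltRHS]splitr ltrD//.
  have := hr (c - c'); rewrite /ball /= !sub0r !normrN => /(_ cr).
  exact: le_lt_trans (ler_norm _).
have c'M : `|c'| <= `|c| + 1.
  rewrite -lerBlDl (le_trans (lerB_dist _ _))// distrC; exact: ltW.
rewrite (le_lt_trans (fnormZ _ M1 c'M))//.
by rewrite mulrC -ltr_pdivlMr// -rhoE.
Qed.

(** If [x_n --> X] then [2 x_(n+1) - x_n --> 2 X - X = X], so [X] is at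
    distance [0] from the limit [0] of that sequence.  The estimate is made
    directly on [- x_n], written as
    [2 (X - x_n) - 2 (X - x_(n+1)) - (2 x_(n+1) - x_n)]; the coefficients
    [2 + 2 + 1] account for [e / 5]. *)
Lemma cvg_averaging_lim0 (x : nat -> RV P) (X : RV P) : x @ \oo --> X ->
  (fun n => 2 *: x n.+1 - x n) @ \oo --> (0 : RV P) -> x @ \oo --> (0 : RV P).
Proof.
move=> xX yX; apply/cvg_ballP => e e0.
have e5 : 0 < e / 5 by rewrite divr_gt0.
have /cvg_ballP/(_ _ e5) hx := xX.
have /cvg_ballP/(_ _ e5) hy := yX.
have hx' : \forall n \near \oo, ball X (e / 5) (x n.+1).
  by case: hx => N _ hN; exists N => // n /= Nn; apply: hN => /=; exact: leqW.
near=> n; rewrite RV_ballE /= rhoE.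
rewrite (_ : 0 - x n =
  2 *: (X - x n) + (- (2 *: (X - x n.+1)) + (0 - (2 *: x n.+1 - x n)))).
  have h1 : fnorm (X - x n) < e / 5.
    by rewrite -rhoE; near: n.
  have h2 : fnorm (X - x n.+1) < e / 5.
    by rewrite -rhoE; near: n.
  have h3 : fnorm (0 - (2 *: x n.+1 - x n)) < e / 5.
    by rewrite -rhoE; near: n.
  have D Z : fnorm (2 *: Z) <= 2 * fnorm Z.
    by apply: fnormZ; rewrite ?ler1n// ger0_norm.
  apply: le_lt_trans (fnormD _ _) _.
  apply: le_lt_trans (lerD (D _) (fnormD _ _)) _.
  by rewrite fnormN; move: (D (X - x n.+1)); lra.
rewrite !scalerBr !sub0r !opprB !scaler_nat !mulr2n.
rewrite (addrC (_ - (X + X))) !subrKA addrC subrKA.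
by rewrite opprD addrA subrr sub0r.
Unshelve. all: by end_near.
Qed.

End fnorm.

(** * Independent rare hits *)

Section example.
Context (R : realType).
Let Omega := product_space (fun k => 'I_k.+1).
Context (P : probability Omega R).
Context (PP : is_product_probability (uniform_ord R) P).

Definition hit k : set Omega := [set w : forall k, 'I_k.+1 | w k = ord0].

Lemma measurable_hit k : measurable (hit k).
Proof.
suff : @coordinate_sets _ (fun k => 'I_k.+1) (hit k).
  exact: sub_sigma_algebra.
by exists k => //; exists [set ord0] => //; rewrite setTI.
Qed.

Lemma uniform_ord_set1 k : uniform_ord R k [set ord0] = (k.+1%:R^-1)%:E.
Proof.
rewrite /uniform_ord (@fintype.eq_card1 _ ord0) ?div1r// => i.
by apply/idP/idP => [/set_mem ->|/eqP ->]; rewrite ?inE.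
Qed.

Lemma uniform_ord_setC1 k :
  uniform_ord R k (~` [set ord0]) = (k%:R / k.+1%:R)%:E.
Proof.
rewrite probability_setC// [X in (1 - X)%E]uniform_ord_set1 -EFinB; congr EFin.
have h : k.+1%:R != 0 :> R by rewrite pnatr_eq0.
apply: (mulIf h); rewrite divfK// mulrBl mulVf// mul1r.
by rewrite -natr1 addrK.
Qed.

Lemma probability_hit n : P (hit n) = (n.+1%:R^-1)%:E.
Proof.
pose A k : set 'I_k.+1 := if k == n then [set ord0] else setT.
have -> : hit n =
    [set w : forall k, 'I_k.+1 | forall k, (k < n.+1)%N -> A k (w k)].
  apply/seteqP; split => w /=.
    by move=> wn k _; rewrite /A; case: eqP => // ->.
  by move=> /(_ n (ltnSn n)); rewrite /A eqxx.
rewrite PP// big_ord_recr big1 /=; last first.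
  by move=> i _; rewrite /A ltn_eqF// probability_setT.
by rewrite mul1e /A eqxx uniform_ord_set1.
Qed.

(** By independence the probability is the product of the [k / (k + 1)] for
    [m <= k < m + d], which telescopes. *)
Lemma probability_no_hit m d : (0 < m)%N ->
  P (\bigcap_(k in [set k | (m <= k < m + d)%N]) ~` hit k) =
  (m%:R / (m + d)%:R)%:E.
Proof.
move=> m0.
pose A k : set 'I_k.+1 := if (k < m)%N then setT else ~` [set ord0].
rewrite (_ : bigcap _ _ =
    [set w : forall k, 'I_k.+1 | forall k, (k < m + d)%N -> A k (w k)]).
  rewrite PP//; elim: d => [|d IH].
    rewrite addn0 divff ?pnatr_eq0 -?lt0n// big1// => i _.
    by rewrite /A ltn_ord probability_setT.
  rewrite addnS big_ord_recr/= IH /A ltnNge leq_addr/= uniform_ord_setC1.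
  by rewrite -EFinM mulrA divfK// pnatr_eq0 -lt0n addn_gt0 m0.
apply/seteqP; split => w /= h k.
  rewrite /A => kd; case: ltnP => // mk; apply: h => /=; exact/andP.
by move=> /= /andP[mk kd]; move: (h k kd); rewrite /A ltnNge mk.
Qed.

(** * A divergent sequence with convergent residuals *)

(** The solution of [2 x_(n+1) - x_n = 2^n 1_(hit n)] started at [0]. *)
Fixpoint bad_seq (n : nat) : RV P :=
  if n is n'.+1 then
    2^-1 *: (bad_seq n' + 2 ^+ n' *: (mindic R (measurable_hit n') : RV P))
  else 0.

Lemma bad_seq_residual n :
  2 *: bad_seq n.+1 - bad_seq n =
  2 ^+ n *: (mindic R (measurable_hit n) : RV P).
Proof. by rewrite /= scalerA divff// scale1r addrC addKr. Qed.

(** Rescaling by [2^n] undoes the halvings: the rescaled sequence is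
    nondecreasing and gains [4^n] at each hit. *)
Lemma bad_seqS n w : 2 ^+ n.+1 * (bad_seq n.+1 : Omega -> R) w =
  2 ^+ n * (bad_seq n : Omega -> R) w + 4 ^+ n * \1_(hit n) w.
Proof.
rewrite (_ : (bad_seq n.+1 : Omega -> R) w =
  2^-1 * ((bad_seq n : Omega -> R) w + 2 ^+ n * \1_(hit n) w))//.
rewrite (_ : 4 = 2 * 2); last by rewrite -natrM.
by rewrite exprS exprMn; field.
Qed.

Lemma bad_seq_ge0 n w : 0 <= (bad_seq n : Omega -> R) w.
Proof.
elim: n => [//|n IH]; rewrite -(pmulr_rge0 _ (_ : 0 < 2 ^+ n.+1)) ?exprn_gt0//.
by rewrite bad_seqS addr_ge0// mulr_ge0 ?exprn_ge0// indicE.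
Qed.

Lemma bad_seq_ge j n w : hit j w -> (j < n)%N ->
  4 ^+ j <= 2 ^+ n * (bad_seq n : Omega -> R) w.
Proof.
move=> jw; elim: n => // n IH; rewrite ltnS leq_eqVlt bad_seqS.
move=> /orP[/eqP <-|/IH jn].
  rewrite indicE mem_set// mulr1 lerDr mulr_ge0 ?exprn_ge0//.
  exact: bad_seq_ge0.
by rewrite (le_trans jn)// lerDl mulr_ge0 ?exprn_ge0// indicE.
Qed.

(** A hit at [k >= m] gives [4^m x_(2m) >= 4^k >= 4^m], that is
    [x_(2m) >= 1]; with probability [1 / 2] there is a hit at some
    [m <= k < 2m], whence [fnorm (x_(2m)) >= phi 1 / 2 = 1 / 4]. *)
Lemma fnorm_bad_seq m : (0 < m)%N -> 4^-1 <= fnorm (bad_seq (m + m)).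
Proof.
move=> m0.
pose B := \bigcap_(k in [set k | (m <= k < m + m)%N]) ~` hit k.
have mB : measurable B.
  apply: bigcap_measurable => [|k _]; last first.
    by apply: measurableC; exact: measurable_hit.
  by exists m; rewrite /= leqnn -ltn_subLR ?subnn.
have PB : fine (P (~` B)) = 2^-1.
  rewrite probability_setC// probability_no_hit//= natrD -mulr2n -mulr_natr.
  have : m%:R != 0 :> R by rewrite pnatr_eq0 -lt0n.
  by move=> ?; field.
rewrite (_ : 4^-1 = 2^-1 * 2^-1); last by field.
rewrite -[X in _ * X]PB; apply: half_probability_le_fnorm.
  exact: measurableC.
move=> w; rewrite setC_bigcap => -[k /= /andP[mk km] /contrapT wk].
rewrite -(@ler_pM2l _ (2 ^+ (m + m))) ?exprn_gt0// mulr1.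
rewrite (le_trans _ (bad_seq_ge wk km))// addnn -mul2n exprM -natrX.
by rewrite ler_eXn2l// ltr1n.
Qed.

Lemma bad_seq_residual_cvg0 :
  (fun n => 2 *: bad_seq n.+1 - bad_seq n) @ \oo --> (0 : RV P).
Proof.
apply/cvg_ballP => e e0.
near=> n; rewrite RV_ballE /= rhoE sub0r fnormN bad_seq_residual.
apply: le_lt_trans (fnorm_le_probability (measurable_hit n) _) _.
  move=> w nw; transitivity (2 ^+ n * \1_(hit n) w : R) => //.
  by rewrite indicE memNset// mulr0.
rewrite probability_hit/=; near: n.
exact: near_infty_natSinv_lt (PosNum e0).
Unshelve. all: by end_near.
Qed.

Lemma bad_seq_not_cvg (X : RV P) : ~ (bad_seq @ \oo --> X).
Proof.
move=> /cvg_averaging_lim0 /(_ bad_seq_residual_cvg0) /cvg_ballP/(_ 4^-1).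
rewrite invr_gt0 ltr0n => /(_ isT) [N _ hN].
suff : fnorm (bad_seq (N.+1 + N.+1)) < 4^-1 by rewrite ltNge fnorm_bad_seq.
rewrite -fnormN -sub0r -rhoE; apply: hN.
by rewrite /= addSn ltnW// ltnS leq_addr.
Qed.

End example.

Theorem proposition3p3 (R : realType)
    (P : probability (product_space (fun k => 'I_k.+1)) R) :
  is_product_probability (uniform_ord R) P ->
  bad_topological_vector_space (RV P).
Proof.
move=> PP; split; first exact: RV_tvs.
move=> /(_ (bad_seq P)) [|X]; last exact: bad_seq_not_cvg.
by exists 0; exact: bad_seq_residual_cvg0.
Qed.
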